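(* Let $s>1$ be an integer. Let $M=\{1^{k_1},2^{k_2},\ldots,n^{k_n}\}$ be a multiset with $n\ge s$ and $k_1,\ldots,k_n$ positive integers, and let $K=k_1+\cdots+k_n$. Then every quasi-Stirling permutation of $M$ contains at most $n-s+1$ occurrences of the pattern $\underline{s\cdots21}$. Moreover, the number of permutations $\pi\in\overline{Q}_M$ with $(\underline{s\cdots21})\pi=n-s+1$ is $(K-n+1)^{n-1}$ if $s=2$, and $K-n+1$ if $s>2$.
   Context: $\{1^{k_1},\ldots,n^{k_n}\}$ denotes the multiset containing $k_\ell$ copies of the letter $\ell$ for each $\ell\in\{1,\ldots,n\}$. A permutation (multipermutation) of $M$ is a word $\pi=\pi_1\pi_2\cdots\pi_K$ of length $K=|M|$ in which each letter $\ell$ occurs exactly $k_\ell$ times. It is a quasi-Stirling permutation if there do not exist indices $j_1<j_2<j_3<j_4$ with $\pi_{j_1}=\pi_{j_3}$, $\pi_{j_2}=\pi_{j_4}$ and $\pi_{j_1}\ne\pi_{j_2}$. $\overline{Q}_M$ is the set of quasi-Stirling permutations of $M$. An occurrence of the consecutive pattern $\underline{s\cdots21}$ in $\pi$ is an index $j$ with $1\le j\le K-s+1$ and $\pi_j>\pi_{j+1}>\cdots>\pi_{j+s-1}$; $(\underline{s\cdots21})\pi$ is the number of such occurrences. *)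

(* Defs.v *)
From mathcomp Require Import all_boot.

Set Implicit Arguments.
Unset Strict Implicit.
Unset Printing Implicit Defensive.

(* The letters 1, ..., n are the elements 0, ..., n - 1 of 'I_n, and k l is the
   multiplicity of l; positions in a word are likewise counted from 0. *)
Definition multiset_card (n : nat) (k : 'I_n -> nat) : nat := \sum_(l < n) k l.

Definition is_multiperm (n : nat) (k : 'I_n -> nat) (K : nat)
    (w : K.-tuple 'I_n) : bool :=
  [forall l : 'I_n, count_mem l w == k l].

Definition quasi_stirling (n K : nat) (w : K.-tuple 'I_n) : bool :=
  ~~ [exists j1 : 'I_K, exists j2 : 'I_K, exists j3 : 'I_K, exists j4 : 'I_K,
        [&& j1 < j2, j2 < j3, j3 < j4,
            tnth w j1 == tnth w j3,
            tnth w j2 == tnth w j4 &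
            tnth w j1 != tnth w j2]].

Definition quasi_stirling_perms (n : nat) (k : 'I_n -> nat) :
    {set (multiset_card k).-tuple 'I_n} :=
  [set w : (multiset_card k).-tuple 'I_n | is_multiperm k w && quasi_stirling w].

(* The bound j + s <= K is needed because take returns a shorter factor near
   the end of the word. *)
Definition is_decreasing_occ (s n K : nat) (w : K.-tuple 'I_n) (j : nat) : bool :=
  (j + s <= K) && sorted (fun a b : 'I_n => b < a) (take s (drop j w)).

(* For s > 0, every occurrence starts at a position j < K. *)
Definition num_decreasing_occ (s n K : nat) (w : K.-tuple 'I_n) : nat :=
  #|[set j : 'I_K | is_decreasing_occ s w j]|.

(* Main.v *)
Require Import Defs.
From mathcomp Require Import all_boot.
From mathcomp Require Import zify.

Set Implicit Arguments.
Unset Strict Implicit.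
Unset Printing Implicit Defensive.

(** Put a sentinel n, larger than all letters 0, ..., n - 1, in front of a word and
    read it from left to right. Call a letter open when it has occurred and has
    copies to come. In a noncrossing word the open letters form a stack: an entry
    is the top of the stack or a letter that has not occurred before
    ([noncrossing_legal], [legal_noncrossing]). When a new letter q is put between
    the last letter p and the top c, the number of descents, counted together
    with the descents that the stack still promises, grows by at most one. Thus
    there are at most n - 1 descents, with equality iff every new letter is tight:
    p = c, or p, q, c is cyclically decreasing ([weak_ascents_bound],
    [descents_bound]).

    An occurrence of the pattern of length s is a start of s - 1 consecutive
    descents. Asking for one more consecutive descent always loses a starting
    point, namely the last one, so there are at most (n - 1) - (s - 2) occurrences
    ([card_run_starts]).

    For s = 2, write K for the length of the word. The extremal words have
    m = K - n + 1 maximal decreasing runs. Such a word is determined by the function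
    that sends a letter to the run of its first occurrence: tightness and this
    function force the word letter by letter ([first_run_inj]). The functions that
    arise are the f : [n] -> [m] for which, for all 0 < t < m, the letters sent to
    the first t runs have together at least t copies beyond their first ones
    ([first_run_ballot], [first_run_onto]). All letters together have m - 1 such
    copies, so by the cycle lemma exactly one of the m rotations of any function
    has this property ([card_ballot]), which leaves m ^ n / m functions.

    For s > 2, equality makes all n - 1 descents consecutive ([single_run]). The word
    then contains n - 1, ..., 1, 0 as a factor and has no other descents; since
    there are no crossings, the other K - n letters, read cyclically from the end
    of the factor to its beginning, are in increasing order
    ([single_descending_run]). Only the place where this circle is cut is free,
    and it can be anywhere but inside the factor, which gives K - n + 1 words. *)

(** * Crossings *)

Lemma subseq_consP (T : eqType) (x : T) (s w : seq T) :
  reflect (exists U V, w = U ++ x :: V /\ subseq s V) (subseq (x :: s) w).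
Proof.
apply: (iffP idP) => [|[U [V [-> sV]]]]; last first.
  by apply: (@cat_subseq _ [::] (x :: s)); [exact: sub0seq | rewrite /= eqxx].
elim: w => [|y w IH] //=; case: eqP => [<- sw|_ /IH[U [V [-> sV]]]].
  by exists [::], w.
by exists (y :: U), V.
Qed.

Definition noncrossing (P : seq nat) :=
  forall a b, a != b -> ~~ subseq [:: a; b; a; b] P.

Lemma subseq_iota s m : sorted ltn s -> {in s, forall i, i < m} -> subseq s (iota 0 m).
Proof.
move=> sorted_s lt_s; apply/subseq_uniqP; rewrite ?iota_uniq //.
apply: (irr_sorted_eq ltn_trans ltnn) => // [|i].
  exact/(sorted_filter ltn_trans)/iota_ltn_sorted.
by rewrite mem_filter mem_iota /= add0n; case: (boolP (i \in s)) => //= /lt_s->.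
Qed.

Lemma subseq_nthP (T : eqType) (x0 : T) (s v : seq T) :
  reflect (exists I, [/\ sorted ltn I, {in I, forall i, i < size v} & s = map (nth x0 v) I])
    (subseq s v).
Proof.
apply: (iffP idP) => [|[I [sI ltI ->]]]; last first.
  by rewrite -[v in subseq _ v](mkseq_nth x0); apply/map_subseq/subseq_iota.
rewrite -{1}(mkseq_nth x0 v) => /subseqP[m _ ->].
exists (mask m (iota 0 (size v))); split; last by rewrite -map_mask.
  exact/(subseq_sorted ltn_trans (mask_subseq _ _))/iota_ltn_sorted.
by move=> i /mem_mask; rewrite mem_iota.
Qed.

Lemma noncrossing_nthP (v : seq nat) :
  noncrossing v <->
  forall i1 i2 i3 i4, i1 < i2 -> i2 < i3 -> i3 < i4 -> i4 < size v ->
    nth 0 v i1 = nth 0 v i3 -> nth 0 v i2 = nth 0 v i4 -> nth 0 v i1 = nth 0 v i2.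
Proof.
split=> [nc i1 i2 i3 i4 i12 i23 i34 i4v e13 e24|nc a b ab].
  apply: contraTeq isT => /nc/negP[]; apply/(subseq_nthP 0).
  exists [:: i1; i2; i3; i4]; split=> [|i|].
  - by rewrite /= i12 i23 i34.
  - have l3 := ltn_trans i34 i4v; have l2 := ltn_trans i23 l3; have l1 := ltn_trans i12 l2.
    by rewrite !inE => /or4P[] /eqP->.
  - by rewrite /= -e13 -e24.
apply/(subseq_nthP 0) => -[I [sI ltI eI]]; have := congr1 size eI; rewrite size_map.
case: I sI ltI eI => [|i1 [|i2 [|i3 [|i4 [|]]]]] //= /and4P[i12 i23 i34 _] ltI [a1 b2 a3 b4] _.
case/eqP: ab; rewrite a1 b2; apply: (nc i1 i2 i3 i4) => //; rewrite -?a1 -?b2 //.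
by apply: ltI; rewrite !inE eqxx !orbT.
Qed.

Lemma noncrossing_rev P : noncrossing (rev P) <-> noncrossing P.
Proof.
have main (Q : seq nat) : noncrossing Q -> noncrossing (rev Q).
  move=> nc a b ab; rewrite -subseq_rev revK.
  by apply: (nc b a); rewrite eq_sym.
by split=> [/main|/main //]; rewrite revK.
Qed.

(** * Words read with a stack *)

Section Scan.

(** A prefix that has been read is kept reversed, so that [head n P] is the last
    letter and the step that follows it is a cons. The sentinel n, larger than
    every letter, stands for a letter in front of the whole word; it is also the
    top of an empty stack. *)
Variables (n : nat) (k : nat -> nat).
Hypothesis k_gt0 : forall x, (0 < k x) = (x < n).

Implicit Types (P U : seq nat) (p q c x : nat).

(** The open letters, those that have occurred and have copies to come. An entry
    that is not new is taken to be the top of the stack, which holds for legal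
    prefixes; hence the [behead] when its last copy has been read. *)
Fixpoint stack P :=
  if P is q :: P' then
    let S := if q \in P' then stack P' else q :: stack P' in
    if count_mem q P < k q then S else behead S
  else [::].

Definition top P := head n (stack P).

Definition legal P q :=
  (count_mem q P < k q) && ((q \in P) ==> (q == top P)).

Definition cyc_decreasing p q c := [|| c < q < p, p < c < q | q < p < c].

(** The gap between the last letter p and the top c is filled by letters that are
    closed again. If p is c itself, no such letter exists yet and any new q is
    tight. Otherwise the letters of the gap, with c before and after them, form a
    cycle, and p, q, c being cyclically decreasing keeps it to a single ascent. *)
Definition tight P q :=
  [|| q \in P, head n P == top P | cyc_decreasing (head n P) q (top P)].

Fixpoint scanned (R : seq nat -> nat -> bool) P :=
  if P is q :: P' then R P' q && scanned R P' else true.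

Definition full P := forall x, count_mem x P = k x.

Lemma scanned_cat R U P : scanned R (U ++ P) -> scanned R P.
Proof. by elim: U => //= q U IH /andP[_ /IH]. Qed.

Lemma scanned_and R1 R2 P :
  scanned (fun P q => R1 P q && R2 P q) P = scanned R1 P && scanned R2 P.
Proof. by elim: P => //= q P ->; rewrite andbACA. Qed.

Lemma legal_count P x : scanned legal P -> count_mem x P <= k x.
Proof.
elim: P => //= q P IH /andP[/andP[cq _] /IH cx].
by case: eqP => [<-|_]; rewrite ?add0n ?add1n.
Qed.

Lemma legal_lt P x : scanned legal P -> x \in P -> x < n.
Proof.
by move=> lP xP; rewrite -k_gt0 (leq_trans _ (legal_count x lP)) // -has_count has_pred1.
Qed.

(** The last two properties say that the stack is ordered both by last and by first
    occurrence: an open letter below a has no occurrence after the first a. *)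
Lemma stack_spec P : scanned legal P ->
  [/\ uniq (stack P),
      forall x, (x \in stack P) = (x \in P) && (count_mem x P < k x),
      subseq (stack P) P
    & pairwise (fun a b => ~~ subseq [:: b; a] P) (stack P)].
Proof.
elim: P => // q P IH /andP[/andP[cq qtop] lP].
have {IH}[uS memS subS pS] := IH lP.
set S := if q \in P then stack P else q :: stack P.
have [S' defS] : exists S', S = q :: S'.
  rewrite /S; case: ifP => qP; last by exists (stack P).
  move: (qtop); rewrite qP /= /top; have: q \in stack P by rewrite memS qP.
  by case: (stack P) => //= c S' _ /eqP->; exists S'.
have uqS : uniq S by rewrite /S; case: ifP => //= qP; rewrite memS qP.
have memqS x : (x \in S) = (x == q) || (x \in P) && (count_mem x P < k x).
  rewrite /S; case: ifP => qP; rewrite ?inE memS //.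
  by case: eqP => // ->; rewrite qP cq.
have subqS : subseq S (q :: P).
  rewrite /S; case: ifP => qP; last by rewrite /= eqxx.
  exact: subseq_trans subS (subseq_cons _ _).
have pqS : pairwise (fun a b => ~~ subseq [:: b; a] (q :: P)) S.
  have main: pairwise (fun a b => ~~ subseq [:: b; a] (q :: P)) S'.
    have : pairwise (fun a b => ~~ subseq [:: b; a] P) S'.
      by move: pS defS; rewrite /S; case: ifP => _ + E; [rewrite E => /andP[]|case: E => <-].
    apply: (sub_in_pairwise (P := mem S')); last by apply/allP.
    move=> a b /= _ bS'; case: eqP => // bq; move: uqS.
    by rewrite defS /= -bq bS'.
  rewrite defS pairwise_cons main andbT; apply/allP => b bS'.
  rewrite /=; case: eqP => [bq|_]; first by move: uqS; rewrite defS /= -bq bS'.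
  move: pS defS; rewrite /S; case: ifP => [_ pS E|qP _ _].
    by move: pS; rewrite E /= => /andP[/allP/(_ b bS')].
  apply/negP => /mem_subseq/(_ q); rewrite !inE eqxx orbT => /(_ isT).
  by rewrite qP.
rewrite /= -/S; case: ifP => cqq.
  split=> // x; rewrite memqS inE; case: eqP => [->|nxq] /=.
    by rewrite cqq.
  by rewrite [q == x]eq_sym (introF eqP nxq).
split.
- by move: uqS; rewrite defS => /andP[].
- move=> x; have := memqS x; rewrite defS /= !inE.
  case: (x =P q) => [->|nxq] /=.
    by rewrite cqq => _; apply/negbTE; move: uqS; rewrite defS => /andP[].
  by rewrite [q == x]eq_sym (introF eqP nxq).
- by apply: subseq_trans subqS; rewrite defS; apply: subseq_cons.
- by move: pqS; rewrite defS pairwise_cons => /andP[].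
Qed.

Lemma mem_stack P x : scanned legal P ->
  (x \in stack P) = (x \in P) && (count_mem x P < k x).
Proof. by case/stack_spec. Qed.

Lemma stack_return P q : scanned legal (q :: P) -> q \in P ->
  exists S, stack P = q :: S /\
    stack (q :: P) = if count_mem q (q :: P) < k q then q :: S else S.
Proof.
move=> /andP[/andP[cq qtop] lP] qP.
have: q \in stack P by rewrite mem_stack // qP.
move: qtop; rewrite qP /= qP /top; case: (stack P) => //= c S /eqP<- _.
by exists S; split => //; case: ifP.
Qed.

Lemma stack_new P q : q \notin P ->
  stack (q :: P) = if 1 < k q then q :: stack P else stack P.
Proof.
move=> qP; rewrite /= (negbTE qP) eqxx; move/count_memPn: qP => ->.
by case: ifP.
Qed.

(** If q returns while another letter c is on top, then c has occurred after the
    last q and has a copy to come, which gives the crossing q c q c. *)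
Lemma noncrossing_legal P : full P -> noncrossing P -> scanned legal P.
Proof.
move=> fP ncP.
suff main U V : P = U ++ V -> scanned legal V by apply: (main [::]).
elim: V U => // q V IH U defP /=.
have lV : scanned legal V by apply: (IH (rcons U q)); rewrite cat_rcons.
rewrite lV andbT; have cq : count_mem q V < k q.
  by rewrite -fP defP count_cat /= eqxx; lia.
rewrite /legal cq; apply/implyP => qV.
have := mem_stack q lV; rewrite qV cq /= /top.
have [_ memV subV _] := stack_spec lV.
case defS: (stack V) => [|c S] //=; rewrite inE; case: eqP => //= qc qS.
have: c \in stack V by rewrite defS mem_head.
rewrite memV => /andP[cV cc].
have cU : c \in U.
  have := fP c; rewrite defP count_cat /= (introF eqP qc) add0n => e.
  by rewrite -has_pred1 has_count; move: cc; rewrite -e -[X in X < _]add0n ltn_add2r.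
have /negP[] := ncP c q (introN eqP (fun e => qc (esym e))).
rewrite defP; apply: (@cat_subseq _ [:: c] [:: q; c; q]); first by rewrite sub1seq.
rewrite /= eqxx; apply: subseq_trans subV; rewrite defS /= eqxx.
by rewrite sub1seq.
Qed.

(** At the second a of a crossing a b a b, the letter b is open; but a has to be on
    top then, and no open letter below it occurs after the first a. *)
Lemma legal_noncrossing P : scanned legal P -> noncrossing P.
Proof.
move=> lP b a ba; apply/negP => /subseq_consP[U [V [defP]]].
case/subseq_consP=> U' [W [defV sW]].
have {}defP : P = (rcons U b ++ U') ++ a :: W by rewrite defP defV cat_rcons -!catA.
have laW := lP; rewrite defP in laW; move/scanned_cat: laW => /= /andP[/andP[_ atop] lW].
have [_ memW _ pW] := stack_spec lW.
have [bW aW] : b \in W /\ a \in W.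
  by split; apply: (mem_subseq sW); rewrite !inE eqxx ?orbT.
have : b \in stack W.
  rewrite memW bW; have := legal_count b lP.
  rewrite defP !count_cat /= -cats1 count_cat /= eqxx; lia.
move: atop pW; rewrite aW /top /=.
case: (stack W) => //= c S /eqP<- /andP[/allP aS _].
by rewrite inE (negbTE ba) => /aS; rewrite sW.
Qed.

(** * Counting letters *)

Lemma sum_letters (F : nat -> nat) S : uniq S -> (forall x, x \in S -> x < n) ->
  \sum_(x < n | (x : nat) \in S) F x = \sum_(x <- S) F x.
Proof.
move=> uS ltS; rewrite -(big_mkord (fun x => x \in S) F) -big_filter.
apply: perm_big; apply: uniq_perm => //; first by rewrite filter_uniq ?iota_uniq.
move=> x; rewrite mem_filter mem_index_iota /=; have := ltS x.
by case: (x \in S) => //= ->.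
Qed.

Lemma size_count P : (forall x, x \in P -> x < n) ->
  size P = \sum_(x < n) count_mem (x : nat) P.
Proof.
elim: P => [|q P IH] ltP /=; first by rewrite big1.
rewrite big_split /= -IH => [|x xP]; last by apply: ltP; rewrite inE xP orbT.
have qn := ltP q (mem_head _ _); rewrite (bigD1 (Ordinal qn)) //= eqxx big1 //.
by move=> i /eqP ni; case: eqP => // e; case: ni; apply: val_inj.
Qed.

Lemma sum_seen (F : nat -> nat) P : scanned legal P ->
  \sum_(x < n | (x : nat) \in P) F x = \sum_(x <- undup P) F x.
Proof.
move=> lP; rewrite -sum_letters ?undup_uniq //; last first.
  by move=> x; rewrite mem_undup; apply: legal_lt.
by apply: eq_bigl => x; rewrite mem_undup.
Qed.

Lemma full_size P : scanned legal P -> size P = \sum_(x < n) k x -> full P.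
Proof.
move=> lP; rewrite size_count => [/eqP|x]; last exact: legal_lt.
have le_ (x : 'I_n) : true -> count_mem (x : nat) P <= k x ?= iff (count_mem (x : nat) P == k x).
  by move=> _; split=> //; apply: legal_count.
rewrite (leqif_sum le_) => /forallP/= eqk x.
have [xn|] := ltnP x n; first by apply/eqP/(eqk (Ordinal xn)).
rewrite leqNgt -k_gt0 -eqn0Ngt => /eqP kx; apply/eqP.
by rewrite eqn_leq legal_count // kx.
Qed.

Lemma full_mem P x : full P -> (x \in P) = (x < n).
Proof. by move=> fP; rewrite -has_pred1 has_count fP k_gt0. Qed.

Lemma full_perm P Q : full P -> full Q -> perm_eq P Q.
Proof. by move=> fP fQ; apply/allP=> x _ /=; rewrite fP fQ. Qed.

(** * The bound on descents *)

(** The pairs of neighbours p <= q in n :: rev P. This is also the index, from 0,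
    of the decreasing run that the last letter belongs to. *)
Fixpoint weak_ascents P :=
  if P is q :: P' then (head n P' <= q) + weak_ascents P' else 0.

Fixpoint stack_drops p S := if S is c :: S' then (c < p) + stack_drops c S' else 0.

(** The descents of the word formed by the last letter and the stack, read from the
    top down. These are the descents still to come if the open letters return with
    no new letters in between. *)
Definition load P := stack_drops (head n P) (stack P).

Lemma top_notin P q : scanned legal P -> q < n -> q \notin P ->
  (head n P != q) && (top P != q).
Proof.
move=> lP qn qP; apply/andP; split.
  apply: contraNneq qP; case: P lP => [|p P] lP /= e; first by rewrite -e ltnn in qn.
  by rewrite e mem_head.
apply: contraNneq qP; rewrite /top.
have := fun x => mem_stack x lP; case: (stack P) => [_ e|c S mS /= <-].
  by rewrite -e ltnn in qn.
by have := mS c; rewrite mem_head => /esym/andP[].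
Qed.

Lemma head_leq P : scanned legal P -> head n P <= n.
Proof. by case: P => [|q P] lP //; apply/ltnW/(legal_lt lP)/mem_head. Qed.

(** Induction on the steps. When the top c returns after p, the change of load
    accounts exactly for the pair p, c. When a new letter q is inserted between
    p and c, the pair p, c is replaced by p, q and q, c at the price of one more
    distinct letter; the two sides change equally unless p differs from c and
    p, q, c has two cyclic ascents, and then the right-hand side gains one. *)
Lemma weak_ascents_bound P : scanned legal P ->
  size P + load P <= weak_ascents P + size (undup P) ?= iff scanned tight P.
Proof.
elim: P => // q P IH lqP.
have /andP[lq lP] := lqP; have [le_ eq_] := IH lP.
rewrite /load [head n _]/= [size _]/= [weak_ascents _]/= [scanned _ _]/= [undup _]/=.
have [qP|qP] := boolP (q \in P).
  rewrite /tight qP orTb andTb; have [S [defS ->]] := stack_return lqP qP.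
  have -> : stack_drops q (if count_mem q (q :: P) < k q then q :: S else S)
      = stack_drops q S.
    by case: ifP; rewrite //= ltnn.
  move: le_ eq_; rewrite /load defS [stack_drops _ (q :: S)]/=.
  move: (head n P) => p.
  by split; [|rewrite -eq_; apply/eqP/eqP]; case: (ltnP q p) (le_) => /=; lia.
have qn : q < n by apply: (legal_lt lqP); rewrite mem_head.
have /andP[pq cq] := top_notin lP qn qP.
rewrite stack_new // /tight (negbTE qP) orFb /cyc_decreasing [size (_ :: _)]/=.
have -> : stack_drops q (if 1 < k q then q :: stack P else stack P)
    = (top P < q) + stack_drops (top P) (behead (stack P)).
  rewrite /top; case: ifP => _; case: (stack P) => [|c S] //=; rewrite ?ltnn //.
  - by rewrite ltnNge (ltnW qn).
  - by rewrite ltnNge (ltnW qn).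
move: le_ eq_; rewrite /load.
have -> : stack_drops (head n P) (stack P)
    = (top P < head n P) + stack_drops (top P) (behead (stack P)).
  rewrite /top; case: (stack P) => [|c S] //=.
  by rewrite ltnNge head_leq.
move=> le_ eq_; move: pq cq le_ eq_.
move: (head n P) (top P) (stack_drops _ _) (scanned _ _) => p c d b.
move: (size P) (size _) (weak_ascents P) => s u a.
case: (ltngtP p q) => // pq _; case: (ltngtP c q) => // cq _;
  case: (ltngtP p c) => pc /= le_ eq_; rewrite ?andbT -?eq_; split; lia.
Qed.

Definition tight_step P q := legal P q && tight P q.

Lemma scanned_tight_step P : scanned tight_step P = scanned legal P && scanned tight P.
Proof. exact: scanned_and. Qed.

Lemma full_weak_ascents_bound P : full P -> scanned legal P ->
  size P <= weak_ascents P + n ?= iff scanned tight P.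
Proof.
move=> fP lP; have := weak_ascents_bound lP.
have -> : size (undup P) = n.
  rewrite -sum1_size -sum_seen // (eq_bigl predT) => [|x]; last by rewrite full_mem ?ltn_ord.
  by rewrite sum1_card card_ord.
suff -> : load P = 0 by rewrite addn0.
rewrite /load; case defS: (stack P) => [|c S] //.
have := mem_stack c lP; rewrite defS mem_head => /esym/andP[_].
by rewrite fP ltnn.
Qed.

Definition descent (v : seq nat) j := (j.+1 < size v) && (nth 0 v j.+1 < nth 0 v j).

Lemma descent_lt v j : descent v j -> j < size v.
Proof. by case/andP=> /ltnW. Qed.

Lemma sum_descents_rcons (u : seq nat) p q :
  \sum_(j < (size u).+2) descent (rcons (rcons u p) q) j
    = \sum_(j < (size u).+1) descent (rcons u p) j + (q < p).
Proof.
rewrite !big_ord_recr /= {2 3 5}/descent !size_rcons !ltnn !ltnS leqnn !addn0.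
rewrite nth_rcons !size_rcons ltnn eqxx nth_rcons size_rcons ltnSn nth_rcons ltnn eqxx.
congr (_ + _); apply: eq_bigr => j _; congr nat_of_bool; have ju := ltn_ord j.
rewrite /descent !size_rcons !ltnS ju (ltnW ju) !nth_rcons !size_rcons !ltnS.
by rewrite ju (ltnW ju).
Qed.

Lemma sum_descents P : {in P, forall x, x < n} ->
  \sum_(j < size P) descent (rev P) j + weak_ascents P = (size P).-1.
Proof.
case: P => [|q P] ltP; first by rewrite big_ord0.
elim: P q ltP => [|p P IH] q ltP.
  by rewrite big_ord1 /= leqNgt ltP ?mem_head.
have := IH p (fun x xP => ltP x (mem_behead (s := q :: p :: P) xP)).
have := sum_descents_rcons (rev P) p q; rewrite size_rev -!rev_cons => -> /=.
by case: ltnP; lia.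
Qed.

(** For a complete word the stack is empty and all n letters have occurred, so that
    at least K - n of its K pairs of neighbours, the pair with the sentinel
    included, are weak ascents. *)
Lemma descents_bound v : 0 < n -> full v -> noncrossing v ->
  \sum_(j < size v) descent v j <= n.-1 ?= iff scanned tight_step (rev v).
Proof.
move=> n0 fv ncv; set S := \sum_(j < _) _.
have fP : full (rev v) by move=> x; rewrite count_rev.
have lP : scanned legal (rev v) by apply: noncrossing_legal; rewrite ?noncrossing_rev.
rewrite scanned_tight_step lP /=; have [le_ <-] := full_weak_ascents_bound fP lP.
have := @sum_descents (rev v) (fun x xP => legal_lt lP xP); rewrite revK size_rev.
have : 0 < size v.
  by rewrite lt0n size_eq0; apply: contraTneq n0 => v0; rewrite -(full_mem 0 fv) v0.
rewrite size_rev in le_ *.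
rewrite -/S; move: S (size v) (weak_ascents _) le_ => S s a le_ s0 e.
by split; [lia | apply/eqP/eqP; lia].
Qed.

(** * Coding by first occurrences *)

(** The index of the decreasing run in which a letter x of P first occurs. *)
Fixpoint first_run P x :=
  if P is q :: P' then if x \in P' then first_run P' x else weak_ascents P else 0.

Lemma first_run_cat U P x : x \in P -> first_run (U ++ P) x = first_run P x.
Proof. by move=> xP; elim: U => //= q U <-; rewrite mem_cat xP orbT. Qed.

Lemma first_run_le P x : first_run P x <= weak_ascents P.
Proof.
by elim: P => //= q P IH; case: ifP => // _; rewrite (leq_trans IH) ?leq_addl.
Qed.

(** Letters of the run of [head n P] that follow it are smaller. *)
Lemma first_run_late U P x : x \in U -> x \notin P ->
  weak_ascents P <= first_run (U ++ P) x /\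
  (first_run (U ++ P) x = weak_ascents P -> x < head n P).
Proof.
elim/last_ind: U P => // U q IH P; rewrite mem_rcons inE cat_rcons.
have [-> _ qP|nxq /= xU xP] := x =P q.
  by rewrite first_run_cat ?mem_head //= (negbTE qP); case: leqP => pq; split; lia.
have xqP : x \notin q :: P by rewrite inE (introF eqP nxq).
have [] := IH (q :: P) xU xqP; rewrite /=.
case: (leqP _ q) => pq; rewrite ?add1n ?add0n => le_ ceq.
  by split; lia.
by split=> // /ceq xq; apply: ltn_trans pq.
Qed.

(** If q' could come next but q does, then q' still has to come in the run that it
    would have been in: the step to q must not overtake that run, and within the
    same run the larger letter comes first. *)
Lemma first_run_order V V' P q q' : full (V ++ q :: P) ->
    first_run (V ++ q :: P) q' = first_run (V' ++ q' :: P) q' ->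
    q != q' -> q' < n -> q' \notin P ->
  (q < head n P) && (q' >= head n P) || ((q < head n P) == (q' < head n P)) && (q' < q).
Proof.
move=> fV e nq q'n q'P.
have q'qP : q' \notin q :: P by rewrite inE eq_sym negb_or nq.
have : q' \in V ++ q :: P by rewrite full_mem.
rewrite mem_cat (negbTE q'qP) orbF => q'V.
have [] := first_run_late q'V q'qP; rewrite e first_run_cat ?mem_head //= (negbTE q'P).
by case: (leqP _ q); case: (leqP _ q') => /=; lia.
Qed.

(** At the first difference, two new letters exclude each other by
    [first_run_order] in both directions. A new letter q' against the return of
    the top is excluded by [first_run_order] in one direction and by the tightness
    of q' in the other. *)
Lemma first_run_inj U U' P : full (U ++ P) -> full (U' ++ P) ->
  scanned tight_step (U ++ P) -> scanned tight_step (U' ++ P) ->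
  (forall x, x < n -> first_run (U ++ P) x = first_run (U' ++ P) x) -> U = U'.
Proof.
elim/last_ind: U U' P => [|U q IH] U' P f1 f2 s1 s2 e12.
  have /perm_size := full_perm f1 f2; rewrite !size_cat add0n => e.
  by apply/esym/size0nil/(@addIn (size P)); rewrite -e.
case/lastP: U' f2 s2 e12 => [|U' q'] f2 s2 e12.
  have /perm_size := full_perm f1 f2; rewrite !size_cat size_rcons /=; lia.
rewrite !cat_rcons in f1 f2 s1 s2 e12.
have [qq'|/eqP nqq'] := q =P q'.
  by rewrite qq' in f1 s1 e12 *; rewrite (IH U' (q' :: P)).
have qn : q < n by rewrite -(full_mem q f1) mem_cat mem_head orbT.
have q'n : q' < n by rewrite -(full_mem q' f2) mem_cat mem_head orbT.
have := first_run_order f1 (e12 _ q'n) nqq' q'n.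
have := first_run_order f2 (esym (e12 _ qn)); rewrite eq_sym => /(_ nqq' qn).
have := scanned_cat s1; have := scanned_cat s2.
rewrite /= /tight_step /legal /tight /cyc_decreasing.
move=> /andP[/andP[/andP[_ t2] c2] _] /andP[/andP[/andP[_ t1] c1] _].
move: t1 t2 c1 c2 nqq'; case: (q \in P); case: (q' \in P) => /=.
- by move=> /eqP-> /eqP->; rewrite eqxx.
- by move=> /eqP<- _ _ c2 nqq' _ /(_ isT); lia.
- by move=> _ /eqP<- c1 _ nqq' /(_ isT) + _; lia.
- by move=> _ _ _ _ nqq' /(_ isT) + /(_ isT); lia.
Qed.

(** The letters that occur in the first t runs must have enough further copies to
    keep the word going into run t. *)
Definition ballot m (g : nat -> nat) :=
  forall t, 0 < t < m -> t <= \sum_(x < n | g x < t) (k x).-1.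

Lemma stack_drops_le p S : stack_drops p S <= size S.
Proof. by elim: S p => //= c S IH p; case: ltnP => _; rewrite ?add0n ?ltnS // leqW. Qed.

(** A weak ascent breaks the chain of descents from the last letter into the stack:
    a tight step p <= q needs p <= c. *)
Lemma load_at_weak_ascent P q : scanned legal P -> tight_step P q -> head n P <= q ->
  load P < size (stack P).
Proof.
move=> lP sq pq; have lqP : scanned legal (q :: P) by case/andP: sq => /= ->.
have qn : q < n by apply: (legal_lt lqP); rewrite mem_head.
have : (head n P <= top P) && (top P != n).
  have [qP|qP] := boolP (q \in P).
    have [S [defS _]] := stack_return lqP qP.
    by rewrite /top defS /= pq neq_ltn qn.
  case/andP: sq => _; rewrite /tight (negbTE qP) /cyc_decreasing; lia.
rewrite /top /load; case: (stack P) => [|c S] /=; first by rewrite eqxx andbF.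
by rewrite [c < _]ltnNge => /andP[-> _]; rewrite ltnS stack_drops_le.
Qed.

(** Every open letter has a copy to come. *)
Lemma size_seen_bound P : scanned legal P ->
  size P + size (stack P) <= size (undup P) + \sum_(x < n | (x : nat) \in P) (k x).-1.
Proof.
move=> lP; have [uS memS _ _] := stack_spec lP.
have Sn x : x \in stack P -> x < n by rewrite memS => /andP[/(legal_lt lP)].
rewrite size_count => [|x]; last exact: legal_lt.
rewrite -(sum1_size (stack P)) -sum_letters // -(sum1_size (undup P)) -sum_seen //.
rewrite [X in X + _](bigID (fun x : 'I_n => (x : nat) \in P)) /=.
rewrite [X in _ + X + _]big1 => [|x xP]; last exact/count_memPn.
rewrite addn0 big_mkcond [X in _ + X]big_mkcond.
rewrite [X in _ <= X + _]big_mkcond [X in _ <= _ + X]big_mkcond -!big_split.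
apply: leq_sum => x _ /=; rewrite memS.
have := legal_count x lP; have := k_gt0 x; rewrite ltn_ord.
by case: (_ \in P) => //= k0 le_; case: ifP => lt_; rewrite ?addn1 ?addn0 add1n prednK.
Qed.

(** Stop before the first letter q of run t. The prefix Q read so far consists of the
    letters with code below t, and it has t - 1 weak ascents, so by
    [weak_ascents_bound] its size is t - 1 less its load plus the number of
    distinct letters. The copies to come exceed the load by at least one. *)
Lemma first_run_ballot P : full P -> scanned tight_step P ->
  ballot (weak_ascents P).+1 (first_run P).
Proof.
move=> fP sP t /andP[t0 tP].
have [U [q [Q [defP aQ aq]]]] : exists U q Q,
    [/\ P = U ++ q :: Q, weak_ascents Q < t & t = weak_ascents (q :: Q)].
  elim: P {fP sP} tP => [|q Q IH]; first by case: t t0.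
  rewrite ltnS; have [taQ _|aQt /= tq] := leqP t (weak_ascents Q).
    by have [U [r [V [-> aV aU]]]] := IH taQ; exists (q :: U), r, V.
  by exists [::], q, Q; split=> //=; case: leqP tq; lia.
have sqQ : scanned tight_step (q :: Q) by apply: (@scanned_cat _ U); rewrite -defP.
have /andP[sq _] := sqQ.
have := @scanned_cat _ [:: q] Q sqQ; rewrite scanned_tight_step => /andP[lQ tQ].
have pq : head n Q <= q by move: aq aQ => -> /=; case: (leqP _ q) => // _; rewrite add0n ltnn.
have [_] := weak_ascents_bound lQ; rewrite tQ => /eqP eQ.
have qQ : \sum_(x < n | first_run P x < t) (k x).-1
    = \sum_(x < n | (x : nat) \in Q) (k x).-1.
  apply: eq_bigl => x; have : (x : nat) \in P by rewrite full_mem.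
  rewrite defP mem_cat inE => xP.
  have [xQ|xQ] := boolP ((x : nat) \in Q).
    by rewrite first_run_cat ?inE ?xQ ?orbT //= xQ (leq_ltn_trans (first_run_le _ _)).
  apply/negbTE; rewrite -leqNgt aq.
  have [<-|xq] := (x : nat) =P q; first by rewrite first_run_cat ?mem_head //= (negbTE xQ).
  have xqQ : (x : nat) \notin q :: Q by rewrite inE negb_or xQ (introN eqP xq).
  case: (@first_run_late U (q :: Q) x) => //.
  by move: xP; rewrite (negbTE xQ) (introF eqP xq) /= orbF.
have := size_seen_bound lQ; have := load_at_weak_ascent lQ sq pq.
move: eQ; rewrite qQ aq /= pq; lia.
Qed.

(** With an empty stack all letters seen so far are used up, so their surplus is
    the number of weak ascents. If no new letter belonged to the current run,
    this would contradict the ballot condition, or the word would be complete. *)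
Lemma candidate_exists m g P :
    (forall x, x < n -> g x < m) -> ballot m g ->
    scanned tight_step P -> size P < \sum_(x < n) k x ->
    (forall x, x \in P -> first_run P x = g x) ->
    (forall x, x < n -> x \notin P -> weak_ascents P <= g x) ->
    stack P = [::] ->
  exists x : 'I_n, ((x : nat) \notin P) && (g x == weak_ascents P).
Proof.
move=> gm bg sP ltP runP geP S0; apply/existsP; apply: contraT => /existsPn none.
have := sP; rewrite scanned_tight_step => /andP[lP tP].
have seen (x : 'I_n) : ((x : nat) \in P) = (g x < (weak_ascents P).+1).
  have [xP|xP] := boolP ((x : nat) \in P); first by rewrite ltnS -runP // first_run_le.
  have := geP _ (ltn_ord x) xP; have := none x; rewrite xP /=.
  by rewrite ltnS; case: ltngtP.
have closed x : x \in P -> count_mem x P = k x.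
  move=> xP; have := mem_stack x lP; rewrite S0 xP /= in_nil => /esym/negbT.
  by rewrite -leqNgt => le_; apply/eqP; rewrite eqn_leq legal_count.
have sizeP : size P = \sum_(x < n | (x : nat) \in P) k x.
  rewrite size_count => [|x]; last exact: legal_lt.
  rewrite (bigID (fun x : 'I_n => (x : nat) \in P)) /=.
  rewrite [X in _ + X]big1 => [|x xP]; last exact/count_memPn.
  by rewrite addn0; apply: eq_bigr => x; apply: closed.
have [lt_m|ge_m] := ltnP (weak_ascents P).+1 m; last first.
  move: ltP; rewrite sizeP [X in _ < X](bigID (fun x : 'I_n => (x : nat) \in P)) /=.
  rewrite [X in _ + X]big1 ?addn0 ?ltnn // => x.
  by rewrite seen (leq_trans (gm _ (ltn_ord x))).
have := bg (weak_ascents P).+1; rewrite lt_m => /(_ isT).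
rewrite -(eq_bigl _ _ seen).
have [_] := weak_ascents_bound lP; rewrite tP /load S0 /= addn0 => /eqP e.
suff : size P = size (undup P) + \sum_(x < n | (x : nat) \in P) (k x).-1.
  by rewrite e addnC => /addnI<-; rewrite ltnn.
rewrite sizeP -(sum1_size (undup P)) -sum_seen // -big_split.
by apply: eq_bigr => x _; rewrite /= add1n prednK // k_gt0.
Qed.

(** A prefix that agrees with g is continued greedily. The candidates are the top of
    the stack and the new letters that would fall into the run prescribed by g.
    Among these the next letter must be in the earliest possible run and, in that
    run, as large as possible, since what follows in the run is smaller. *)
Lemma first_run_onto m g P N :
    (forall x, x < n -> g x < m) -> ballot m g ->
    scanned tight_step P -> size P + N = \sum_(x < n) k x ->
    (forall x, x \in P -> first_run P x = g x) ->
    (forall x, x < n -> x \notin P ->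
      weak_ascents P <= g x /\ (g x = weak_ascents P -> x < head n P)) ->
  exists U, [/\ full (U ++ P), scanned tight_step (U ++ P)
    & forall x, x < n -> first_run (U ++ P) x = g x].
Proof.
move=> gm bg; elim: N P => [|N IH] P sP sizeP runP geP.
  rewrite addn0 in sizeP; exists [::] => /=.
  have fP : full P by apply: full_size => //; move: sP; rewrite scanned_tight_step => /andP[].
  by split=> // x xn; rewrite runP // full_mem.
have := sP; rewrite scanned_tight_step => /andP[lP tP].
have [_ memS _ _] := stack_spec lP.
pose cand (x : 'I_n) := ((x : nat) \in P) && ((x : nat) == top P) ||
  ((x : nat) \notin P) && (g x == weak_ascents ((x : nat) :: P)).
(* Lexicographic: letters that stay in the current run first, then by size. *)
pose key x := (x < head n P) * n + x.
have topS c S : stack P = c :: S -> (c \in P) /\ (c < n).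
  move=> defS; have := memS c; rewrite defS mem_head => /esym/andP[cP _].
  by rewrite cP (legal_lt lP).
have S0 : stack P = [::] -> exists2 x : 'I_n, cand x & x < head n P.
  case/(candidate_exists gm bg sP _ runP) => [|x xn /(geP x xn)[]//|x /andP[xP gx]].
    by lia.
  have [_ /(_ (eqP gx)) xp] := geP x (ltn_ord x) xP.
  by exists x; rewrite // /cand xP (negbTE xP) /= leqNgt xp (eqP gx) add0n eqxx.
have [x0 cx0] : exists x0 : 'I_n, cand x0.
  case defS: (stack P) => [|c S]; first by have [x0] := S0 defS; exists x0.
  have [cP cn] := topS _ _ defS.
  by exists (Ordinal cn); rewrite /cand /= cP /top defS eqxx.
case: (@arg_maxnP _ x0 cand (fun x : 'I_n => key x) cx0) => q cq maxq.
have sq : tight_step P q.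
  rewrite /tight_step /legal /tight; move: cq; rewrite /cand.
  have [qP /=|qP /=] := boolP ((q : nat) \in P).
    rewrite orbF => qtop; rewrite qtop /= !andbT.
    have : (q : nat) \in stack P; last by rewrite memS => /andP[].
    move: qtop; rewrite /top; case: (stack P) => [|c S] /= /eqP e.
      by have := ltn_ord q; rewrite e ltnn.
    by rewrite e mem_head.
  move=> gq; rewrite (count_memPn qP) k_gt0 ltn_ord /=.
  have /andP[pq tq] := top_notin lP (ltn_ord q) qP.
  rewrite /cyc_decreasing; move: pq tq (ltn_ord q) maxq; rewrite /key /top.
  case defS: (stack P) => [|c S] /= pq tq qn maxq.
    by have [x cx xp] := S0 defS; have := maxq x cx; rewrite xp; have := head_leq lP; lia.
  have [cP cn] := topS _ _ defS.
  have := maxq (Ordinal cn); rewrite /cand /= cP /top defS eqxx => /(_ isT).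
  by case: (ltnP c (head n P)); case: (ltnP q (head n P)) => /=; lia.
have gq : (q : nat) \notin P -> g q = weak_ascents ((q : nat) :: P).
  by move: cq; rewrite /cand => /orP[/andP[->]|/andP[_ /eqP]].
have [] := IH ((q : nat) :: P).
- by rewrite /= sq.
- by rewrite /= -sizeP addnS.
- move=> x; rewrite inE /= => /predU1P[->|xP]; last by rewrite xP runP.
  by case: ifP => [/runP //|/negbT/gq].
- move=> x xn; rewrite inE negb_or => /andP[xq xP].
  have [ge_ lt_] := geP x xn xP.
  have := maxq (Ordinal xn); rewrite /cand /key /= (negbTE xP) /=.
  have := ltn_ord q.
  by case: (leqP (head n P) q); case: (leqP (head n P) x) => /=; lia.
- move=> U [fU sU cU]; exists (rcons U q).
  by rewrite cat_rcons.
Qed.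

(** * Words with a single decreasing run of all letters *)

Definition letters_down := rev (iota 0 n).

Definition surplus := sort leq (flatten [seq nseq (k x).-1 x | x <- iota 0 n]).

(** Read cyclically, all these words are the decreasing word of all letters followed
    by the sorted surplus copies; j is the place where the circle is cut. *)
Definition spliced j := drop j surplus ++ letters_down ++ take j surplus.

Lemma letters_downE i : i < n -> nth 0 letters_down i = n.-1 - i.
Proof. by move=> ltin; rewrite nth_rev size_iota // nth_iota; lia. Qed.

Lemma subseq_letters_down a b : a < b -> b < n -> subseq [:: b; a] letters_down.
Proof.
move=> ab bn; rewrite -subseq_rev revK; apply: subseq_iota => [|i]; first by rewrite /= ab.
by rewrite !inE => /orP[]/eqP->; rewrite // (ltn_trans ab).
Qed.

Lemma count_surplus x : count_mem x surplus = (k x).-1.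
Proof.
rewrite (permP (permEl (perm_sort _ _))) count_flatten -map_comp sumnE big_map.
have [xn|] := ltnP x n; last first.
  rewrite leqNgt -k_gt0 -eqn0Ngt => kx; rewrite (eqP kx) big1_seq // => i /=.
  by rewrite mem_iota add0n count_nseq /= -k_gt0; case: eqP => // ->; rewrite (eqP kx).
rewrite (bigD1_seq x) ?mem_iota ?iota_uniq //= count_nseq /= eqxx mul1n.
by rewrite big1 ?addn0 // => i /negbTE ix; rewrite count_nseq /= ix.
Qed.

Lemma surplus_lt x : x \in surplus -> x < n.
Proof. by rewrite -has_pred1 has_count count_surplus -k_gt0; lia. Qed.

Lemma size_surplus : size surplus + n = \sum_(x < n) k x.
Proof.
rewrite size_count; last exact: surplus_lt.
rewrite -[X in _ + X]card_ord -sum1_card -big_split; apply: eq_bigr => x _.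
by rewrite /= count_surplus addn1 prednK // k_gt0.
Qed.

Lemma sorted_surplus : sorted leq surplus.
Proof. exact/sort_sorted/leq_total. Qed.

Lemma count_letters_down x : count_mem x letters_down = (x < n).
Proof. by rewrite count_rev count_uniq_mem ?iota_uniq // mem_iota. Qed.

Lemma full_spliced j : full (spliced j).
Proof.
move=> x; have e : count_mem x (drop j surplus) + count_mem x (take j surplus) = (k x).-1.
  by rewrite addnC -count_cat cat_take_drop count_surplus.
rewrite !count_cat addnCA e.
by rewrite count_letters_down -k_gt0; case: (k x).
Qed.

(** The first block followed by the letter n - 1 is increasing, the second block is
    decreasing, the third is increasing and lies below the first. *)
Lemma nth_spliced j i1 i2 :
    0 < n -> j <= size surplus -> i1 < i2 -> i2 < size (spliced j) ->
  let a := size surplus - j in let v := nth 0 (spliced j) in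
  [/\ i2 <= a -> v i1 <= v i2,
      a <= i1 -> i2 < a + n -> v i2 < v i1,
      a + n <= i1 -> v i1 <= v i2
    & i1 < a -> a + n <= i2 -> v i2 <= v i1].
Proof.
move=> n0 jC i12 i2v a v; have ltn_drop : size (drop j surplus) = a by rewrite size_drop.
have size_down : size letters_down = n by rewrite size_rev size_iota.
have sizev : size (spliced j) = a + n + j.
  by rewrite !size_cat ltn_drop size_down size_takel // addnA.
rewrite sizev in i2v.
have srt x y : x <= y -> y < size surplus -> nth 0 surplus x <= nth 0 surplus y.
  move=> xy yC; apply: (sorted_leq_nth leq_trans leqnn _ sorted_surplus) => //.
  exact: leq_ltn_trans yC.
have vA i : i < a -> v i = nth 0 surplus (j + i).
  by move=> ia; rewrite /v nth_cat ltn_drop ia nth_drop.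
have vD i : a <= i -> i < a + n -> v i = n.-1 - (i - a).
  move=> ai ian; rewrite /v nth_cat ltn_drop ltnNge ai /= nth_cat size_down.
  have ina : i - a < n by lia.
  by rewrite ina letters_downE.
have vB i : a + n <= i -> i < a + n + j -> v i = nth 0 surplus (i - (a + n)).
  move=> ani ij; rewrite /v nth_cat ltn_drop ltnNge (leq_trans _ ani) ?leq_addr //=.
  have ina : n <= i - a by lia.
  have inj : i - a - n < j by lia.
  by rewrite nth_cat size_down ltnNge ina /= nth_take // subnDA.
split=> [i2a|ai1 i2an|ani1|i1a ani2].
- have i1a := leq_trans i12 i2a; rewrite (vA i1) //.
  move: i2a; rewrite leq_eqVlt => /predU1P[->|i2a]; last by rewrite vA // srt; lia.
  have ji : j + i1 < size surplus by lia.
  have : nth 0 surplus (j + i1) < n by apply/surplus_lt/mem_nth.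
  by rewrite vD //; lia.
- by rewrite !vD; lia.
- by rewrite !vB ?srt; lia.
- by rewrite (vA i1) // (vB i2) // srt; lia.
Qed.

(** The comparisons of [nth_spliced] between the four positions of a crossing are
    contradictory, wherever the positions lie. *)
Lemma noncrossing_spliced j : 0 < n -> j <= size surplus -> noncrossing (spliced j).
Proof.
move=> n0 jC; apply/noncrossing_nthP => i1 i2 i3 i4 i12 i23 i34 i4v.
have [? ? ? ?] := nth_spliced n0 jC i12 (ltn_trans i23 (ltn_trans i34 i4v)).
have [? ? ? ?] := nth_spliced n0 jC i23 (ltn_trans i34 i4v).
have [? ? ? ?] := nth_spliced n0 jC i34 i4v.
have [? ? ? ?] := nth_spliced n0 jC (ltn_trans i12 (ltn_trans i23 i34)) i4v.
lia.
Qed.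

Lemma size_spliced j : size (spliced j) = size surplus + n.
Proof.
rewrite !size_cat addnCA [X in _ + X]addnC -size_cat cat_take_drop addnC.
by rewrite size_rev size_iota.
Qed.

Lemma descent_spliced j i : 0 < n -> j <= size surplus ->
  size surplus - j <= i < size surplus - j + n.-1 -> descent (spliced j) i.
Proof.
move=> n0 jC /andP[ai ian]; have isz : i.+1 < size (spliced j) by rewrite size_spliced; lia.
have [_ h _ _] := nth_spliced n0 jC (ltnSn i) isz.
by rewrite /descent isz h //; lia.
Qed.

(** The first descent marks the place of the decreasing block. *)
Lemma spliced_inj : 1 < n -> {in [pred j | j <= size surplus] &, injective spliced}.
Proof.
move=> n1 j j'; rewrite !inE; wlog lt_jj' : j j' / j < j' => [hw jC j'C e|jC j'C e].
  by have [/hw->|/hw/(_ j'C jC (esym e))|] := ltngtP j j'.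
have n0 := ltnW n1.
have : descent (spliced j') (size surplus - j') by apply: descent_spliced => //; lia.
rewrite -e => /andP[sz]; rewrite ltnNge => /negP[].
by case: (nth_spliced n0 jC (ltnSn _) sz) => + _ _ _; apply; lia.
Qed.

(** The n letters of the run can only be n - 1, ..., 0. Around it, A and B are
    increasing. If b in B were larger than c in A, then c, the b and c of the run,
    and b would cross; so B ++ A is sorted, and its letters are the surplus copies. *)
Lemma single_descending_run v a : 1 < n -> full v -> noncrossing v ->
    (forall i, descent v i = (a <= i < a + n.-1)) ->
  exists2 j, j <= size surplus & v = spliced j.
Proof.
move=> n1 fv ncv dv.
have sz : a + n <= size v.
  have : descent v (a + n.-2) by rewrite dv; lia.
  by case/andP=> + _; lia.
have ltv i : i < size v -> nth 0 v i < n by move=> iv; rewrite -(full_mem _ fv) mem_nth.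
have down i : a <= i < a + n.-1 -> nth 0 v i.+1 < nth 0 v i by rewrite -dv => /andP[].
have vD i : i < n -> nth 0 v (a + i) = n.-1 - i.
  have up t : t < n -> nth 0 v (a + t) + t < n.
    elim: t => [|t IH] tn; first by rewrite !addn0 ltv //; lia.
    have at_ : a <= a + t < a + n.-1 by lia.
    by have := IH (ltnW tn); have := down _ at_; rewrite (addnS a); lia.
  have lo t : t < n -> t <= nth 0 v (a + (n.-1 - t)).
    elim: t => // t IH tn; have at_ : a <= a + (n.-1 - t.+1) < a + n.-1 by lia.
    have := IH (ltnW tn); have := down _ at_.
    have -> : (a + (n.-1 - t.+1)).+1 = a + (n.-1 - t) by lia.
    by move=> lt_ le_; apply: leq_ltn_trans lt_.
  move=> ltin; have := up i ltin; have li : n.-1 - i < n by lia.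
  have := lo _ li; have -> : n.-1 - (n.-1 - i) = i by lia.
  by lia.
set A := take a v; set B := drop (a + n) v.
have defv : v = A ++ letters_down ++ B.
  rewrite -[LHS](cat_take_drop a); congr (_ ++ _).
  rewrite -[LHS](cat_take_drop n) drop_drop [n + a]addnC; congr (_ ++ _).
  have szn : size (take n (drop a v)) = n by rewrite size_takel // size_drop; lia.
  apply: (@eq_from_nth _ 0) => [|i]; first by rewrite szn size_rev size_iota.
  by rewrite szn => ltin; rewrite nth_take // nth_drop vD // letters_downE.
have weak i : i.+1 < size v -> ~~ (a <= i < a + n.-1) -> nth 0 v i <= nth 0 v i.+1.
  by move=> iv; rewrite -dv /descent iv -leqNgt.
have sA : sorted leq A.
  apply/(sortedP 0) => i; rewrite size_takel; last lia.
  by move=> ia; rewrite !nth_take ?weak //; lia.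
have sB : sorted leq B.
  by apply/(sortedP 0) => i; rewrite size_drop !nth_drop addnS => iB; apply: weak; lia.
have sBA : sorted leq (B ++ A).
  move: sA sB; rewrite !(sorted_pairwise leq_trans) pairwise_cat => -> ->.
  rewrite !andbT; apply/allrelP => b c bB cA; rewrite leqNgt; apply/negP => cb.
  have /negP[] := ncv c b (negbT (ltn_eqF cb)); rewrite defv.
  apply: (@cat_subseq _ [:: c]); first by rewrite sub1seq.
  apply: (@cat_subseq _ [:: b; c]); last by rewrite sub1seq.
  apply: subseq_letters_down => //.
  by rewrite -(full_mem _ fv) defv !mem_cat bB !orbT.
have eBA : B ++ A = surplus.
  apply: (sorted_eq leq_trans anti_leq sBA sorted_surplus).
  apply/allP => x _ /=; rewrite count_surplus count_cat.
  have := fv x; rewrite defv !count_cat count_letters_down -k_gt0.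
  case: (k x) => [|m]; first by rewrite add0n addnC => ->.
  by rewrite addnCA addnC addn1 addnC => -[->].
exists (size B); first by rewrite -eBA size_cat leq_addr.
by rewrite /spliced -eBA drop_size_cat // take_size_cat.
Qed.

End Scan.

(** * The cycle lemma *)

Section CycleLemma.

Variables (T : finType) (x : T -> nat) (M : nat).
Hypothesis sum_x : \sum_l x l = M.

Implicit Types (f : {ffun T -> 'I_M.+1}) (r : 'I_M.+1) (s t : nat).

Definition weight_below f t := \sum_(l | f l < t) x l.

(** Here f distributes letters over M + 1 runs; the condition for t = 0 is void. *)
Definition ballot_fun f := [forall t : 'I_M.+1, t <= weight_below f t].

(** Subtraction of r modulo M + 1. *)
Definition rot_val r s := if r <= s then s - r else s + M.+1 - r.

Lemma rot_val_lt r (a : 'I_M.+1) : rot_val r a < M.+1.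
Proof. by rewrite /rot_val; have := ltn_ord a; have := ltn_ord r; case: (leqP r a); lia. Qed.

Definition rot_fun r f : {ffun T -> 'I_M.+1} := [ffun l => Ordinal (rot_val_lt r (f l))].

Lemma rot_fun_inj r : injective (rot_fun r).
Proof.
move=> f g /ffunP e; apply/ffunP => l; apply: val_inj.
have := congr1 val (e l); rewrite !ffunE /= /rot_val.
have := ltn_ord (f l); have := ltn_ord (g l); have := ltn_ord r.
by case: (leqP r (f l)); case: (leqP r (g l)) => /=; lia.
Qed.

Lemma weight_below_rot r f t : t <= M ->
  weight_below (rot_fun r f) t + weight_below f r
    = weight_below f (r + t) + weight_below f (r + t - M.+1).
Proof.
move=> tM; rewrite /weight_below !(big_mkcond (fun l => _ < _)) -!big_split.
apply: eq_bigr => l _; rewrite ffunE /= /rot_val.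
have := ltn_ord (f l); have := ltn_ord r.
by case: (leqP r (f l)); case: (ltnP _ t); case: (ltnP _ (r + t));
  case: (ltnP _ (r + t - _)) => /=; lia.
Qed.

Lemma weight_below_big f t : M < t -> weight_below f t = M.
Proof.
by move=> Mt; rewrite -[RHS]sum_x; apply: eq_bigl => l; rewrite (leq_trans (ltn_ord _)).
Qed.

Lemma weight_below0 f : weight_below f 0 = 0.
Proof. by rewrite /weight_below big_pred0. Qed.

(** Orders the r lexicographically by weight_below f r - r, shifted by M + 1 to keep
    it a natural number, and then by r. *)
Definition excess f r := (weight_below f r + M.+1 - r) * M.+1 + r.

Lemma leq_lex m a b r s : r < m -> s < m ->
  (a * m + r <= b * m + s) = (a < b) || (a == b) && (r <= s).
Proof.
move=> rm sm; case: ltngtP => [ab|ba|->] /=; last by rewrite leq_add2l.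
- by apply/idP; nia.
- by apply/negbTE; nia.
Qed.

(** Rotating by r compares the walk t |-> weight_below f t - t with its value at r.
    As the walk loses 1 over a full turn, the positions before r must be strictly
    higher and those after r at least as high: r is the first minimum. *)
Lemma ballot_rot r f :
  ballot_fun (rot_fun r f) = [forall s, excess f r <= excess f s].
Proof.
apply/forallP/forallP => h.
  move=> s; rewrite leq_lex ?ltn_ord //.
  have := ltn_ord r; have := ltn_ord s; have [rs|sr] := leqP r s => sM rM.
    have tM : s - r < M.+1 by lia.
    have /= := h (Ordinal tM); rewrite -(leq_add2r (weight_below f r)).
    by rewrite weight_below_rot // subnKC // (eqP (ltnW sM)) weight_below0; lia.
  have tM : s + M.+1 - r < M.+1 by lia.
  have /= := h (Ordinal tM); rewrite -(leq_add2r (weight_below f r)).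
  rewrite weight_below_rot // subnKC; last lia.
  by rewrite [weight_below f (_ + _)]weight_below_big ?addnK; lia.
move=> t; rewrite -(leq_add2r (weight_below f r)) weight_below_rot; last by rewrite -ltnS.
have := ltn_ord r; have := ltn_ord t; have [rtM|Mrt] := ltnP (r + t) M.+1 => tM rM.
  have := h (Ordinal rtM); rewrite leq_lex //=.
  by rewrite (eqP (ltnW rtM)) weight_below0; lia.
have sM : r + t - M.+1 < M.+1 by lia.
have := h (Ordinal sM); rewrite leq_lex //= [weight_below f (r + t)]weight_below_big //; lia.
Qed.

Lemma excess_inj f : injective (excess f).
Proof.
move=> r s e; apply: val_inj => /=.
have : excess f r <= excess f s by rewrite e.
have : excess f s <= excess f r by rewrite e.
by rewrite !leq_lex //; lia.
Qed.

(** Every function has exactly one rotation that satisfies the ballot condition. *)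
Lemma card_ballot : #|[set f | ballot_fun f]| * M.+1 = M.+1 ^ #|T|.
Proof.
pose low f := [arg min_(r < ord0) excess f r].
have lowE f r : (low f == r) = ballot_fun (rot_fun r f).
  rewrite ballot_rot /low; case: arg_minnP => // a _ amin.
  apply/eqP/forallP => [<- s|rmin]; first exact: amin.
  by apply: (@excess_inj f); apply/eqP; rewrite eqn_leq amin // rmin.
have <- : #|{ffun T -> 'I_M.+1}| = M.+1 ^ #|T| by rewrite card_ffun card_ord.
rewrite -[RHS]sum1_card (partition_big low predT) //= mulnC.
rewrite (eq_bigr (fun=> #|[set f | ballot_fun f]|)) => [|r _].
  by rewrite sum_nat_const card_ord.
rewrite -sum1_card; apply/esym.
rewrite [LHS](reindex_inj (@rot_fun_inj r)) /=.
by apply: eq_bigl => f; rewrite inE lowE.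
Qed.

End CycleLemma.

(** * Consecutive descents *)

Section Runs.

Variables (K : nat) (D : pred nat).
Hypothesis D_lt : forall j, D j -> j < K.

Definition run_starts r := [set j : 'I_K | [forall i : 'I_r, D (j + i)]].

Lemma run_startsP r (j : 'I_K) :
  reflect (forall i, i < r -> D (j + i)) (j \in run_starts r).
Proof.
rewrite inE; apply: (iffP forallP) => h i; last exact: h.
by move=> ir; apply: (h (Ordinal ir)).
Qed.

Lemma run_starts1 (j : 'I_K) : (j \in run_starts 1) = D j.
Proof.
apply/run_startsP/idP => [/(_ 0 isT)|Dj [|//] _]; by rewrite addn0.
Qed.

Lemma run_startsS r : run_starts r.+1 \subset run_starts r.
Proof.
by apply/subsetP => j /run_startsP h; apply/run_startsP => i ir; apply/h/leqW.
Qed.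

(** The largest starting point is lost when one more step is asked for. *)
Lemma last_run_start r : 0 < r -> run_starts r != set0 ->
  exists2 e, e \in run_starts r & e \notin run_starts r.+1.
Proof.
move=> r0 /set0Pn[j0 j0r]; case: (@arg_maxnP _ j0 (mem (run_starts r)) val j0r) => e er emax.
exists e => //; apply/run_startsP => h.
have e1 : e.+1 < K by apply: D_lt; rewrite -addn1; apply: h.
have : Ordinal e1 \in run_starts r by apply/run_startsP => i ir; rewrite /= addSnnS h.
by move/emax => /=; rewrite /geq /= ltnn.
Qed.

Lemma card_run_starts_step r : 0 < r -> #|run_starts r.+1| <= #|run_starts r|.-1.
Proof.
move=> r0; have [e|] := set_0Vmem (run_starts r).
  by rewrite e cards0 leqn0 cards_eq0 -subset0 -e run_startsS.
case=> j jr; have [|e er eS] := last_run_start r0.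
  by apply/set0Pn; exists j.
have : #|run_starts r.+1| < #|run_starts r|.
  by apply/proper_card/properP; split; [exact: run_startsS | exists e].
by case: #|run_starts r|.
Qed.

Lemma card_run_starts q r : 0 < q -> #|run_starts (q + r)| <= #|run_starts q| - r.
Proof.
move=> q0; elim: r => [|r IH]; first by rewrite addn0 subn0.
rewrite addnS; apply: leq_trans (card_run_starts_step _) _; first by lia.
by move: IH; case: #|_|; lia.
Qed.

(** With equality in [card_run_starts], passing from runs of length 1 to runs of
    length 2 loses a single point e. Hence D is closed under successor except at
    e, which makes it an interval that ends at e. *)
Lemma single_run d r : 1 < r -> 0 < #|run_starts r| -> #|run_starts 1| <= d ->
    #|run_starts r| = d.+1 - r ->
  exists a, forall j, D j = (a <= j < a + d).
Proof.
move=> r1 r0 le_d eq_r.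
have := @card_run_starts 2 (r - 2) isT; rewrite subnKC // => le2.
have le21 := @card_run_starts_step 1 isT.
have {le_d} eq1 : #|run_starts 1| = d by lia.
have {le2 eq_r le21} eq2 : (#|run_starts 2|).+1 = d by lia.
have [e e1 e2] : exists2 e, e \in run_starts 1 & e \notin run_starts 2.
  by apply: last_run_start => //; rewrite -card_gt0; lia.
have succ_D j : D j -> j != e -> D j.+1.
  move=> Dj je; have jK := D_lt Dj.
  have : Ordinal jK \in run_starts 2.
    have -> : run_starts 2 = run_starts 1 :\ e.
      apply/eqP; rewrite eqEcard subsetD1 e2 run_startsS /=.
      by rewrite -ltnS eq2 -eq1 [X in _ < X](cardsD1 e) e1.
    by rewrite !inE -val_eqE je /=; apply/forallP => -[[|//] ?]; rewrite /= addn0.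
  by move/run_startsP/(_ 1 isT); rewrite addn1.
have {e1} De : D e by rewrite -run_starts1.
have le_e j : D j -> j <= e.
  elim: {j}(K - j) {-2}j (leqnn (K - j)) => [|N IH] j le_ Dj; have jK := D_lt Dj; first by lia.
  have [->//|je] := eqVneq j (val e).
  by apply/ltnW/IH; [lia | exact: succ_D].
have exD : exists j, D j by exists (val e).
case: (ex_minnP exD) => a Da amin.
have DE j : D j = (a <= j <= e).
  apply/idP/andP => [Dj|[aj je]]; first by rewrite amin // le_e.
  elim: j aj je => [|j IH]; first by rewrite leqn0 => /eqP<-.
  rewrite leq_eqVlt => /orP[/eqP<- //|aj] je.
  by apply: succ_D; [apply: IH; lia | lia].
have ae := le_e _ Da.
have dE : d = e.+1 - a.
  rewrite -eq1 -sum1_card.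
  rewrite -[RHS]muln1 -sum_nat_const_nat (@big_nat_widen _ _ _ _ _ K) ?D_lt //.
  by rewrite big_geq_mkord; apply: eq_bigl => i; rewrite run_starts1 DE ltnS andbC.
by exists a => j; rewrite DE dE subnKC // leqW.
Qed.

End Runs.

(** * From tuples to words of natural numbers *)

Lemma card_bij_in (A B : finType) (f : A -> B) (S : {set A}) (R : {set B}) :
    {in S &, injective f} -> {in S, forall a, f a \in R} ->
    {in R, forall b, exists2 a, a \in S & f a = b} ->
  #|S| = #|R|.
Proof.
move=> f_inj f_in f_onto; rewrite -(card_in_imset f_inj); apply: eq_card => b.
by apply/imsetP/idP => [[a aS ->]|/f_onto[a aS <-]]; [exact: f_in | exists a].
Qed.

Section Words.

Variables (n : nat) (k : 'I_n -> nat).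
Hypothesis k_gt0 : forall l, 0 < k l.

Notation K := (multiset_card k).
Implicit Types w : K.-tuple 'I_n.

(** Extended by 0, so that the letters are the numbers of positive multiplicity. *)
Definition mult (x : nat) := oapp k 0 (insub x).

Lemma mult_ord (l : 'I_n) : mult l = k l.
Proof. by rewrite /mult valK. Qed.

Lemma mult_gt0 x : (0 < mult x) = (x < n).
Proof. by rewrite /mult; case: insubP => [l -> _|/negbTE->] //=; apply: k_gt0. Qed.

Lemma sum_mult : \sum_(x < n) mult x = K.
Proof. by apply: eq_bigr => l _; rewrite mult_ord. Qed.

Lemma sum_mult_pred : \sum_(l < n) (k l).-1 + n = K.
Proof.
rewrite -[X in _ + X]card_ord -sum1_card -big_split; apply: eq_bigr => l _.
by rewrite /= addn1 prednK.
Qed.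

Definition letters w : seq nat := map val w.

Lemma size_letters w : size (letters w) = K.
Proof. by rewrite size_map size_tuple. Qed.

Lemma nth_letters w (j : 'I_K) : nth 0 (letters w) j = tnth w j.
Proof. by rewrite (nth_map (tnth w j)) ?size_tuple // -tnth_nth. Qed.

Lemma letters_inj : injective letters.
Proof. by move=> w w' /(inj_map val_inj)/val_inj. Qed.

Lemma letters_full w : full mult (letters w) <-> is_multiperm k w.
Proof.
have cnt (l : 'I_n) : count_mem (l : nat) (letters w) = count_mem l w.
  by rewrite count_map; apply: eq_count => i /=; rewrite val_eqE.
split=> [fw|/forallP mw x]; first by apply/forallP => l; rewrite -cnt fw mult_ord.
rewrite /mult; case: insubP => [l _ <-|nx] /=; first by rewrite cnt; apply/eqP.
by apply/count_memPn; apply: contra nx => /mapP[l _ ->]; apply: ltn_ord.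
Qed.

Lemma letters_onto v : full mult v -> exists w, letters w = v.
Proof.
move=> fv; have ltv : {in v, forall x, x < n} by move=> x; rewrite (full_mem mult_gt0).
have e : map val (pmap insub v : seq 'I_n) = v.
  rewrite (pmap_filter (insubK _)); apply/all_filterP/allP => x /ltv xn.
  by rewrite insubT.
have sz : size (pmap insub v : seq 'I_n) == K.
  rewrite -sum_mult -(size_map val) e (@size_count n) //.
  by apply/eqP; apply: eq_bigr => x _; apply: fv.
by exists (Tuple sz).
Qed.

Lemma letters_noncrossing w : noncrossing (letters w) <-> quasi_stirling w.
Proof.
rewrite noncrossing_nthP size_letters; split=> [nc|].
  apply/negP => /'exists_'exists_'exists_existsP[j1 [j2 [j3 [j4]]]].
  case/and5P=> j12 j23 j34 /eqP e13 /andP[/eqP e24 /negP[]].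
  apply/eqP/val_inj; rewrite /= -!nth_letters.
  by apply: (nc j1 j2 j3 j4); rewrite // !nth_letters ?e13 ?e24.
move=> qs i1 i2 i3 i4 i12 i23 i34 i4K e13 e24; apply/eqP; apply: contraNT qs => n12.
have i3K := ltn_trans i34 i4K; have i2K := ltn_trans i23 i3K; have i1K := ltn_trans i12 i2K.
apply/existsP; exists (Ordinal i1K); apply/existsP; exists (Ordinal i2K).
apply/existsP; exists (Ordinal i3K); apply/existsP; exists (Ordinal i4K).
by rewrite -!val_eqE /= -!nth_letters /= i12 i23 i34 e13 e24 !eqxx -e13 -e24.
Qed.

Lemma quasi_stirling_permsP w :
  reflect (full mult (letters w) /\ noncrossing (letters w)) (w \in quasi_stirling_perms k).
Proof.
by rewrite inE; apply: (iffP andP) => -[/letters_full ? /letters_noncrossing ?].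
Qed.

(** An occurrence of the pattern of length r + 1 is a start of r consecutive
    descents. *)
Lemma num_decreasing_occE r w : 0 < r ->
  num_decreasing_occ r.+1 w = #|run_starts K (descent (letters w)) r|.
Proof.
move=> r0; apply: eq_card => j; rewrite [LHS]inE.
have -> : is_decreasing_occ r.+1 w j
    = (j + r.+1 <= K) && sorted (fun a b => b < a) (take r.+1 (drop j (letters w))).
  by rewrite /letters -map_drop -map_take sorted_map.
apply/andP/run_startsP => [[jrK /(sortedP 0) h] i ir|h].
  have ijK : (j + i).+1 < K by lia.
  have szt : size (take r.+1 (drop j (letters w))) = r.+1.
    by rewrite size_takel // size_drop size_letters; lia.
  have := h i; rewrite szt ltnS => /(_ ir).
  by rewrite /descent size_letters ijK !nth_take ?ltnS ?(ltnW ir) // !nth_drop addnS.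
have jrK : j + r.+1 <= K.
  have rr : r.-1 < r by rewrite prednK.
  have /andP[] := h _ rr; rewrite size_letters => + _; lia.
split=> //; apply/(sortedP 0) => i.
rewrite size_takel ?size_drop ?size_letters; last by lia.
rewrite ltnS => ir; have /andP[_] := h i ir.
by rewrite !nth_take ?ltnS ?(ltnW ir) // !nth_drop addnS.
Qed.

Lemma card_descents w :
  #|run_starts K (descent (letters w)) 1| = \sum_(j < size (letters w)) descent (letters w) j.
Proof.
rewrite size_letters -sum1_card big_mkcond; apply: eq_bigr => j _.
by rewrite run_starts1; case: descent.
Qed.

Lemma descent_letters_lt w j : descent (letters w) j -> j < K.
Proof. by move/descent_lt; rewrite size_letters. Qed.

Lemma quasi_stirling_descents w : 0 < n -> w \in quasi_stirling_perms k ->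
  #|run_starts K (descent (letters w)) 1| <= n.-1
    ?= iff scanned (tight_step n mult) (rev (letters w)).
Proof.
move=> n0 /quasi_stirling_permsP[fw nw]; rewrite card_descents.
exact: descents_bound mult_gt0 _ n0 fw nw.
Qed.

Lemma num_decreasing_occ_bound s w : 1 < s -> s <= n -> w \in quasi_stirling_perms k ->
  num_decreasing_occ s w <= n - s + 1.
Proof.
case: s => // r; rewrite ltnS => r0 rn wQ; rewrite num_decreasing_occE //.
have [le_ _] := quasi_stirling_descents (leq_ltn_trans (leq0n r) rn) wQ.
have := @card_run_starts K (descent (letters w)) (@descent_letters_lt w) 1 r.-1 isT.
by rewrite add1n prednK // => h; apply: leq_trans h _; lia.
Qed.

(** * Counting the extremal words *)

Notation m := (\sum_(l < n) (k l).-1).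

Definition first_runs w : {ffun 'I_n -> 'I_m.+1} :=
  [ffun l => inord (first_run n (rev (letters w)) (l : 'I_n))].

Lemma tight_weak_ascents w : w \in quasi_stirling_perms k ->
  scanned (tight_step n mult) (rev (letters w)) -> weak_ascents n (rev (letters w)) = m.
Proof.
case/quasi_stirling_permsP => fw _; rewrite scanned_tight_step => /andP[lP tP].
have fP : full mult (rev (letters w)) by move=> x; rewrite count_rev.
have [_] := full_weak_ascents_bound mult_gt0 fP lP; rewrite tP size_rev size_letters.
by rewrite -sum_mult_pred eqn_add2r => /eqP.
Qed.

Lemma first_runsE w (l : 'I_n) : w \in quasi_stirling_perms k ->
    scanned (tight_step n mult) (rev (letters w)) ->
  first_runs w l = first_run n (rev (letters w)) l :> nat.
Proof.
by move=> wQ sw; rewrite ffunE inordK // ltnS -(tight_weak_ascents wQ sw) first_run_le.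
Qed.

(** The first-run code is a bijection from the extremal words onto the ballot
    functions, which the cycle lemma counts; here m + 1 = K - n + 1. *)
Lemma card_max_descents : 1 < n ->
  #|[set w in quasi_stirling_perms k | num_decreasing_occ 2 w == n.-1]| = m.+1 ^ n.-1.
Proof.
move=> n1; have n0 := ltnW n1.
set S := [set w in _ | _].
have memS w : (w \in S)
    = (w \in quasi_stirling_perms k) && scanned (tight_step n mult) (rev (letters w)).
  rewrite inE num_decreasing_occE //; apply: andb_id2l => wQ.
  by have [_ ->] := quasi_stirling_descents n0 wQ.
have wt_gt0 : 0 < m.+1 by [].
apply/eqP; rewrite -(eqn_pmul2r wt_gt0) -expnSr prednK // -[X in _ ^ X]card_ord.
rewrite -(@card_ballot _ (fun l : 'I_n => (k l).-1) _ erefl) eqn_pmul2r //; apply/eqP.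
have weightE (f : {ffun 'I_n -> 'I_m.+1}) (g : nat -> nat) t :
    (forall l : 'I_n, f l = g l :> nat) ->
  weight_below (fun l => (k l).-1) f t = \sum_(x < n | g x < t) (mult x).-1.
  by move=> fg; apply: eq_big => l; rewrite ?fg ?mult_ord.
apply: (card_bij_in (f := first_runs)).
- move=> w w'; rewrite !memS => /andP[wQ sw] /andP[w'Q sw'] e.
  apply: letters_inj; apply: (can_inj revK).
  have [/quasi_stirling_permsP[fw _] /quasi_stirling_permsP[fw' _]] := (wQ, w'Q).
  have fP : full mult (rev (letters w) ++ [::]) by move=> x; rewrite cats0 count_rev.
  have fP' : full mult (rev (letters w') ++ [::]) by move=> x; rewrite cats0 count_rev.
  apply: (first_run_inj mult_gt0 fP fP'); rewrite ?cats0 // => x xn.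
  by rewrite -(first_runsE (Ordinal xn) wQ sw) e (first_runsE (Ordinal xn) w'Q sw').
- move=> w; rewrite memS => /andP[wQ sw]; rewrite inE; apply/forallP => t.
  have /quasi_stirling_permsP[fw _] := wQ.
  have fP : full mult (rev (letters w)) by move=> x; rewrite count_rev.
  rewrite (weightE _ _ _ (fun l => first_runsE l wQ sw)).
  have [->//|t0] := posnP t.
  apply: (first_run_ballot mult_gt0 fP sw); rewrite t0 (tight_weak_ascents wQ sw) //=.
- move=> f; rewrite inE => /forallP bf.
  pose g x := oapp (fun l => f l : nat) 0 (insub x : option 'I_n).
  have gE (l : 'I_n) : f l = g l :> nat by rewrite /g valK.
  have [|||||U [fU sU cU]] := @first_run_onto n mult mult_gt0 m.+1 g [::] K _ _ isT.
  + by move=> x xn; rewrite -(gE (Ordinal xn)).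
  + by move=> t /andP[_ tm]; rewrite -(weightE f _ _ gE); apply: (bf (Ordinal tm)).
  + by rewrite add0n sum_mult.
  + by [].
  + by move=> x xn _; split.
  rewrite cats0 in fU sU cU.
  have [|w wU] := @letters_onto (rev U); first by move=> x; rewrite count_rev.
  have rw : rev (letters w) = U by rewrite wU revK.
  have wQ : w \in quasi_stirling_perms k.
    apply/quasi_stirling_permsP; rewrite wU noncrossing_rev; split=> [x|].
      by rewrite count_rev.
    by apply: (@legal_noncrossing n mult); move: sU; rewrite scanned_tight_step => /andP[].
  have sw : scanned (tight_step n mult) (rev (letters w)) by rewrite rw.
  exists w; first by rewrite memS wQ sw.
  by apply/ffunP => l; apply: val_inj; rewrite /= (first_runsE l wQ sw) rw cU ?gE.
Qed.

Lemma size_surplusE : size (surplus n mult) = m.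
Proof.
apply/eqP; rewrite -(eqn_add2r n) (size_surplus mult_gt0) sum_mult.
by rewrite sum_mult_pred.
Qed.

(** Equality forces one block of n - 1 consecutive descents, so the extremal words
    are the spliced words, one for each cut j <= m. *)
Lemma card_max_runs s : 2 < s -> s <= n ->
  #|[set w in quasi_stirling_perms k | num_decreasing_occ s w == n - s + 1]| = m.+1.
Proof.
move=> s2 sn; have s1 := ltnW s2; have n1 : 1 < n by apply: leq_trans sn.
have n0 := ltnW n1; set S := [set w in _ | _].
have memS w : reflect (exists2 j, j <= m & letters w = spliced n mult j) (w \in S).
  rewrite inE; apply: (iffP andP) => [[wQ]|[j jm wj]].
    have [fw nw] := quasi_stirling_permsP _ wQ.
    case: s s1 s2 sn @S => // r r0 r1 rn _; rewrite num_decreasing_occE // => /eqP e.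
    have [le_ _] := quasi_stirling_descents n0 wQ.
    have [||a dE] := single_run (@descent_letters_lt w) r1 _ le_.
    - by rewrite e addn1.
    - by rewrite e; lia.
    rewrite -size_surplusE; exact: (single_descending_run mult_gt0 n1 fw nw dE).
  have wQ : w \in quasi_stirling_perms k.
    apply/quasi_stirling_permsP; rewrite wj; split; first exact: (full_spliced mult_gt0).
    by apply: (noncrossing_spliced mult_gt0 n0); rewrite size_surplusE.
  split=> //; rewrite eqn_leq num_decreasing_occ_bound //=.
  case: s s1 s2 sn @S => // r r0 r1 rn _; rewrite num_decreasing_occE //.
  have aK (t : 'I_(n - r.+1 + 1)) : m - j + t < K.
    by have := ltn_ord t; rewrite -sum_mult_pred; lia.
  rewrite -[X in X <= _]card_ord -(card_imset predT (f := fun t => Ordinal (aK t))).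
    apply/subset_leq_card/subsetP => _ /imsetP[t _ ->].
    apply/run_startsP => i ir /=; rewrite wj; apply: (descent_spliced mult_gt0 n0).
      by rewrite size_surplusE.
    by rewrite size_surplusE -addnA leq_addr ltn_add2l; have := ltn_ord t; lia.
  by move=> t t' /(congr1 val)/addnI/val_inj.
pose words := [seq spliced n mult j | j <- iota 0 m.+1].
have uw : uniq words.
  rewrite map_inj_in_uniq ?iota_uniq // => i j; rewrite !mem_iota !ltnS => im jm.
  by apply: (spliced_inj mult_gt0 n1); rewrite inE size_surplusE.
have sz : size words = m.+1 by rewrite size_map size_iota.
have idx w : w \in S -> letters w \in words.
  by case/memS => j jm ->; apply: map_f; rewrite mem_iota.
have nth_words j : j < m.+1 -> nth [::] words j = spliced n mult j.
  by move=> jm; rewrite (nth_map 0) ?size_iota // nth_iota.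
clearbody words.
rewrite -[RHS]card_ord -cardsT.
apply: (card_bij_in (f := fun w => inord (index (letters w) words) : 'I_m.+1)) => //.
- move=> w w' /idx wS /idx w'S /(congr1 val); rewrite /= !inordK -?sz ?index_mem // => e.
  by apply: letters_inj; rewrite -[LHS](nth_index [::] wS) e nth_index.
- move=> j _; have [|w wj] := @letters_onto (spliced n mult j).
    exact: (full_spliced mult_gt0).
  exists w; first by apply/memS; exists j; rewrite // -ltnS.
  by apply: val_inj; rewrite /= wj -nth_words // index_uniq ?sz // inordK.
Qed.

End Words.

Theorem corollary1p3 (s n : nat) (k : 'I_n -> nat)
    (hs : 1 < s) (hn : s <= n) (hk : forall l : 'I_n, 0 < k l) :
  (forall w : (multiset_card k).-tuple 'I_n,
      w \in quasi_stirling_perms k -> num_decreasing_occ s w <= n - s + 1) /\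
  #|[set w in quasi_stirling_perms k | num_decreasing_occ s w == n - s + 1]| =
    (if s == 2 then (multiset_card k - n + 1) ^ (n - 1)
     else multiset_card k - n + 1).
Proof.
split=> [w|]; first exact: num_decreasing_occ_bound.
have -> : multiset_card k - n + 1 = (\sum_(l < n) (k l).-1).+1.
  by rewrite -(sum_mult_pred hk) addnK addn1.
case: (eqVneq s 2) => [s2|s2]; last by apply: card_max_runs; rewrite // ltn_neqAle eq_sym s2.
have n1 : 1 < n by rewrite -s2.
rewrite s2 subn1 -(card_max_descents hk n1).
by have -> : n - 2 + 1 = n.-1 by lia.
Qed.
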